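(* Let $a,b,c,d,e,f,g,h,i$ be integers such that $a^2,b^2,\dots,i^2$ are nine distinct integers arranged in the $3\times 3$ grid $$\begin{array}{c|c|c} a^2 & b^2 & c^2\\ \hline d^2 & e^2 & f^2\\ \hline g^2 & h^2 & i^2\end{array}$$ such that the entries of each row, each column, and each of the two main diagonals sum to the same total, and suppose $\gcd(a^2,b^2,\dots,i^2)=1$. Then every prime $p$ dividing the central entry $e^2$ satisfies either $p=2$ or $p\equiv 1 \pmod 4$.
   Context: Such a grid is called a magic square of squares; it is called primitive if the greatest common divisor of all nine entries is $1$. The central entry is $e^2$. *)

(* Defs.v *)
From HB Require Import structures.
From mathcomp Require Import all_boot all_order all_algebra.
Set Implicit Arguments.
Unset Strict Implicit.
Unset Printing Implicit Defensive.
Import GRing.Theory Num.Theory.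
Local Open Scope ring_scope.

Definition magic_square (M : 'M[int]_3) : Prop :=
  exists t : int,
    [/\ forall k : 'I_3, \sum_(l < 3) M k l = t,
        forall l : 'I_3, \sum_(k < 3) M k l = t,
        \sum_(k < 3) M k k = t
      & \sum_(k < 3) M k (rev_ord k) = t].

Definition distinct_entries (M : 'M[int]_3) : Prop :=
  forall k l k' l' : 'I_3, M k l = M k' l' -> k = k' /\ l = l'.

Definition primitive_square (M : 'M[int]_3) : Prop :=
  \big[gcdz/0]_(k < 3) \big[gcdz/0]_(l < 3) M k l = 1.

(* The grid is given by its entries in row-major order. *)
Definition grid3 (a b c d e f g h i : int) : 'M[int]_3 :=
  \matrix_(k < 3, l < 3) [:: a; b; c; d; e; f; g; h; i]`_(3 * k + l)%N.

(* Main.v *)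
Require Import Defs.
From mathcomp Require Import all_boot all_order all_algebra all_field.
From mathcomp Require Import ring zify.
Import GRing.Theory Num.Theory.
Local Open Scope ring_scope.

(** In a magic square the four lines through the centre force the common sum to
    be three times the centre, so opposite entries add up to [2 e^2].  If a
    prime [p = 3 mod 4] divides [e^2], it divides four sums of two squares and
    hence, as [-1] is not a square modulo [p], all nine entries. *)

(** Raising [u ^+ 2 = - v ^+ 2] to the odd power [(p - 1) / 2] keeps the sign, which Fermat's little
    theorem turns into [u * v = - (u * v)] in ['F_p]. *)
Lemma dvdz_sum_sqr_3mod4 {p : nat} {x y : int} :
  prime p -> (p %% 4 = 3)%N -> (p%:Z %| x ^+ 2 + y ^+ 2)%Z -> (p%:Z %| x)%Z.
Proof.
move=> p_pr p_mod4 p_dvd; have pcharFp := pchar_Fp p_pr.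
move: p_dvd; rewrite !(dvdz_pcharf pcharFp) rmorphD !rmorphXn /=.
move: (x%:~R : 'F_p) (y%:~R : 'F_p) => u v; rewrite addr_eq0 => /eqP u2.
have fermat (w : 'F_p) : w ^+ p = w by have := expf_card w; rewrite card_Fp.
(* The exponent [(p - 1) / 2], written so that its oddness is visible. *)
have def_p : p = (2 * (p %/ 4).*2.+1).+1 by lia.
have pX (w : 'F_p) : w ^+ p = (w ^+ 2) ^+ (p %/ 4).*2.+1 * w.
  by rewrite -exprM -exprSr -def_p.
(* Fermat is applied to [u] on the left and to [v] on the right; working with the product avoids
   dividing by [v]. *)
have uNv : u * v = - (u * v).
  rewrite -{1}(fermat u) -{2}(fermat v) !pX u2 exprNn -signr_odd /= odd_double.
  by rewrite expr1; ring.
have two_neq0 : (2%:R : 'F_p) != 0.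
  rewrite -(dvdn_pcharf pcharFp) gtnNdvd //.
  by have := prime_gt1 p_pr; lia.
have : 2%:R * (u * v) == 0 by rewrite mulr_natl mulr2n {2}uNv subrr.
rewrite mulf_eq0 (negPf two_neq0) orFb mulf_eq0 => /orP[//|/eqP v0].
by rewrite -sqrf_eq0 u2 v0 expr0n oppr0.
Qed.

(** The four lines through the centre cover the grid once and the centre three more times, so
    [4 * t = 3 * t + 3 * e]. *)
Lemma magic_square_opposite {a b c d e f g h i : int} :
  magic_square (grid3 a b c d e f g h i) ->
  [/\ a + i = 2 * e, b + h = 2 * e, c + g = 2 * e & d + f = 2 * e].
Proof.
case=> t [rows cols diag anti].
have := (rows 0, rows 1, rows 2%:R, cols 0, cols 1, cols 2%:R, diag, anti).
by rewrite !big_ord_recl !big_ord0 !mxE /=;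
   case=> -[[[[[[? ?] ?] ?] ?] ?] ?] ?; split; lia.
Qed.

Lemma primitive_square_dvd {M : 'M[int]_3} {p : int} :
  primitive_square M -> (forall k l, (p %| M k l)%Z) -> (p %| 1%R)%Z.
Proof.
move=> <- p_dvd.
have dvd_gcd m n : (p %| m)%Z -> (p %| n)%Z -> (p %| gcdz m n)%Z.
  by rewrite dvdz_gcd => -> ->.
(* Both nested gcds start from [0], which [p] divides. *)
by do 2![apply: (big_ind (fun m => (p %| m)%Z)) => // ? _].
Qed.

Theorem theorem3p1 (a b c d e f g h i : int)
  (hdistinct : distinct_entries
     (grid3 (a ^+ 2) (b ^+ 2) (c ^+ 2)
            (d ^+ 2) (e ^+ 2) (f ^+ 2)
            (g ^+ 2) (h ^+ 2) (i ^+ 2)))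
  (hmagic : magic_square
     (grid3 (a ^+ 2) (b ^+ 2) (c ^+ 2)
            (d ^+ 2) (e ^+ 2) (f ^+ 2)
            (g ^+ 2) (h ^+ 2) (i ^+ 2)))
  (hprim : primitive_square
     (grid3 (a ^+ 2) (b ^+ 2) (c ^+ 2)
            (d ^+ 2) (e ^+ 2) (f ^+ 2)
            (g ^+ 2) (h ^+ 2) (i ^+ 2)))
  (p : nat) (hp : prime p) (hpe : (p%:Z %| e ^+ 2)%Z) :
  p = 2%N \/ (p = 1 %[mod 4])%N.
Proof.
have [p2|p_odd] := even_prime hp; first by left.
have [|p_mod4] : (p %% 4 = 1)%N \/ (p %% 4 = 3)%N by lia.
  by right.
have [ai bh cg df] := magic_square_opposite hmagic.
have dvd_sqr (x y : int) : x ^+ 2 + y ^+ 2 = 2 * e ^+ 2 ->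
    (p%:Z %| x ^+ 2)%Z /\ (p%:Z %| y ^+ 2)%Z.
  move=> xy; have p_xy : (p%:Z %| x ^+ 2 + y ^+ 2)%Z by rewrite xy dvdz_mull.
  (* The divisibility lemma speaks of the first summand only, so the sum is also taken in the other
     order. *)
  have p_yx := p_xy; rewrite addrC in p_yx.
  by split; rewrite expr2 dvdz_mulr // (dvdz_sum_sqr_3mod4 hp p_mod4 p_xy,
    dvdz_sum_sqr_3mod4 hp p_mod4 p_yx).
have [[pa pi] [pb ph]] := (dvd_sqr _ _ ai, dvd_sqr _ _ bh).
have [[pc pg] [pd pf]] := (dvd_sqr _ _ cg, dvd_sqr _ _ df).
have /(primitive_square_dvd hprim) : forall k l, (p%:Z %|
    grid3 (a ^+ 2) (b ^+ 2) (c ^+ 2) (d ^+ 2) (e ^+ 2) (f ^+ 2)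
          (g ^+ 2) (h ^+ 2) (i ^+ 2) k l)%Z.
  (* Eight entries come from the opposite pairs, the centre from [hpe]. *)
  by case=> [[|[|[|//]]] ?] [[|[|[|//]]] ?]; rewrite mxE.
by rewrite dvdzE absz_nat dvdn1 => /eqP p1; rewrite p1 in hp.
Qed.
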